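(* The nine graphs $\mathrm{NC}^0_{60},\dots,\mathrm{NC}^6_{60}$, $\mathrm{NC}^7_{84}$, $\mathrm{NC}^8_{84}$ defined below are pairwise non-isomorphic, connected, cubic, vertex-transitive, non-symmetric, non-Cayley graphs, and each has a non-solvable full automorphism group.
   Context: For a finite group $G$, a subgroup $H$ and a union $D$ of double cosets of $H$ with $D^{-1}=D$, the coset graph $\mathrm{Cos}(G,H,D)$ has vertex set the right cosets of $H$ in $G$ and edges $\{Hg,Hdg\}$ for $g\in G$, $d\in D$. A graph is vertex-transitive if its automorphism group is transitive on vertices, symmetric if it is transitive on arcs, and Cayley if its automorphism group contains a subgroup acting regularly on the vertices; a VNC-graph is a vertex-transitive non-Cayley graph. Permutations are written in cycle notation and composed left to right. Define $\mathrm{NC}^i_{12p}=\mathrm{Cos}(G,H,HaH\cup HbH)$ with the following data, where $S_5$, $A_5$ act on $\{1,\dots,5\}$, and $A_5\times\mathbb{Z}_2$, $S_5\times\mathbb{Z}_2$ denote $A_5\times\langle(6\,7)\rangle$, $S_5\times\langle(6\,7)\rangle\le S_7$: $\mathrm{NC}^0_{60}$: $G=S_5$, $H=\langle(1\,3)(2\,5)\rangle$, $a=(1\,2\,4\,5\,3)$, $b=(2\,5)$. $\mathrm{NC}^1_{60}$: $G=A_5\times\mathbb{Z}_2$, $H=\langle(2\,3)(4\,5)\rangle$, $a=(2\,5)(3\,4)(6\,7)$, $b=(1\,2)(3\,4)(6\,7)$. $\mathrm{NC}^2_{60}$: $G=A_5\times\mathbb{Z}_2$, $H=\langle(2\,3)(4\,5)\rangle$,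 $a=(1\,2\,4\,5\,3)$, $b=(2\,4)(3\,5)(6\,7)$. $\mathrm{NC}^3_{60}$: $G=A_5\times\mathbb{Z}_2$, $H=\langle(2\,3)(4\,5)\rangle$, $a=(1\,3\,5\,4\,2)(6\,7)$, $b=(2\,4)(3\,5)$. $\mathrm{NC}^4_{60}$: $G=S_5\times\mathbb{Z}_2$, $H=\langle(1\,3),(4\,5)\rangle$, $a=(1\,3\,2)(4\,5)$, $b=(1\,5\,3\,4)(6\,7)$. $\mathrm{NC}^5_{60}$: $G=S_5\times\mathbb{Z}_2$, $H=\langle(1\,3)(6\,7),(4\,5)(6\,7)\rangle$, $a=(2\,5)$, $b=(1\,4\,3\,5)(6\,7)$. $\mathrm{NC}^6_{60}$: $G=S_5\times\mathbb{Z}_2$, $H=\langle(1\,3)(6\,7),(4\,5)(6\,7)\rangle$, $a=(2\,4)$, $b=(1\,4)(3\,5)(6\,7)$. $\mathrm{NC}^7_{84}$: $H=\langle(1\,7)(2\,4)(3\,8),(1\,4)(2\,7)(5\,6)\rangle$, $a=(1\,8\,4)(2\,7\,3)$, $b=(1\,4\,2\,7)(3\,6\,8\,5)$, and $G=\langle H,a,b\rangle\le S_8$, a group isomorphic to $\mathrm{PGL}(2,7)$. $\mathrm{NC}^8_{84}$: $H=\langle(1\,6)(2\,4)(3\,7)(5\,8),(1\,4)(2\,6)(3\,8)(5\,7)\rangle$, $a=(1\,3\,5\,2\,6\,7\,8\,4)$, $b=(1\,5\,2\,3)(4\,8\,6\,7)$, and $G=\langle H,a,b\rangle\le S_8$,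 a group isomorphic to $\mathrm{PGL}(2,7)$. *)

(* Defs.v *)
From HB Require Import structures.
From mathcomp Require Import all_boot all_fingroup all_solvable.

Set Implicit Arguments.
Unset Strict Implicit.
Unset Printing Implicit Defensive.

Local Open Scope group_scope.

(** * Finite simple graphs *)

Record sgraph := SGraph {
  vertex : finType;
  adj : rel vertex;
  adj_sym : symmetric adj;
  adj_irr : irreflexive adj }.

Definition isomorphic (X Y : sgraph) : Prop :=
  exists2 f : vertex X -> vertex Y, bijective f &
    forall x y, adj (f x) (f y) = adj x y.

Definition connected (X : sgraph) : Prop :=
  forall x y : vertex X, connect (@adj X) x y.

Definition cubic (X : sgraph) : Prop :=
  forall x : vertex X, #|[set y | adj x y]| = 3.

Definition Aut_set (X : sgraph) : {set {perm vertex X}} :=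
  [set s : {perm vertex X} | [forall x, forall y, adj (s x) (s y) == adj x y]].

Lemma Aut_setP (X : sgraph) (s : {perm vertex X}) :
  reflect (forall x y, adj (s x) (s y) = adj x y) (s \in Aut_set X).
Proof.
rewrite inE; apply: (iffP forallP) => [h x y|h x].
  by have /forallP/(_ y)/eqP := h x.
by apply/forallP => y; apply/eqP.
Qed.

Lemma Aut_group_set (X : sgraph) : group_set (Aut_set X).
Proof.
apply/group_setP; split=> [|s t /Aut_setP hs /Aut_setP ht]; apply/Aut_setP.
  by move=> x y; rewrite !perm1.
by move=> x y; rewrite !permM ht hs.
Qed.

Definition Autg (X : sgraph) : {group {perm vertex X}} := Group (Aut_group_set X).

Definition vertex_transitive (X : sgraph) : Prop :=
  [transitive Autg X, on [set: vertex X] | 'P].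

Definition symmetric_graph (X : sgraph) : Prop :=
  forall x y x' y' : vertex X, adj x y -> adj x' y' ->
    exists2 s : {perm vertex X}, s \in Autg X & s x = x' /\ s y = y'.

Definition regular_on (T : finType) (R : {group {perm T}}) : Prop :=
  [transitive R, on [set: T] | 'P] /\ forall x : T, 'C_R[x | 'P] = 1.

Definition Cayley (X : sgraph) : Prop :=
  exists2 R : {group {perm vertex X}}, R \subset Autg X & regular_on R.

(** * Coset graphs *)

(* [H * D * H = D] says that D is a union of double cosets of H; disjointness
   from H is what makes the coset graph loopless. *)
Record connection_set (gT : finGroupType) (G H : {group gT}) (D : {set gT}) :
    Prop := ConnectionSet {
  cs_subG : H \subset G;
  cs_subD : D \subset G;
  cs_double : H * D * H = D;
  cs_inv : D^-1 = D;
  cs_disjoint : [disjoint D & H] }.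

Definition Cos_vertex (gT : finGroupType) (G H : {group gT}) : finType :=
  {Hg : {set gT} | Hg \in rcosets H G}.

Definition Cos_edges (gT : finGroupType) (G H : {group gT}) (D : {set gT}) :
    {set {set {set gT}}} :=
  [set [set H :* g; H :* (d * g)] | g in G, d in D].

Definition Cos_adj (gT : finGroupType) (G H : {group gT}) (D : {set gT}) :
    rel (Cos_vertex G H) :=
  fun x y => [set val x; val y] \in Cos_edges G H D.

Lemma Cos_adj_sym (gT : finGroupType) (G H : {group gT}) (D : {set gT}) :
  symmetric (@Cos_adj gT G H D).
Proof. by move=> x y; rewrite /Cos_adj setUC. Qed.

Lemma Cos_adj_irr (gT : finGroupType) (G H : {group gT}) (D : {set gT}) :
  connection_set G H D -> irreflexive (@Cos_adj gT G H D).
Proof.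
move=> cD x; apply/negP; rewrite /Cos_adj setUid => /imset2P[g d _ dD e].
have /set1P e1 : H :* g \in [set val x] by rewrite e set21.
have /set1P e2 : H :* (d * g) \in [set val x] by rewrite e set22.
have : d * g \in H :* g by rewrite e1 -e2 rcoset_refl.
rewrite mem_rcoset mulgK => dH.
by have /pred0P/(_ d) := cs_disjoint cD; rewrite /= dD dH.
Qed.

Definition Cos (gT : finGroupType) (G H : {group gT}) (D : {set gT})
    (cD : connection_set G H D) : sgraph :=
  SGraph (@Cos_adj_sym gT G H D) (Cos_adj_irr cD).

(* HaH \cup HbH *)
Definition dcosets2 (gT : finGroupType) (H : {group gT}) (a b : gT) : {set gT} :=
  (H :* a * H) :|: (H :* b * H).

Lemma dcosets2_connection (gT : finGroupType) (G H : {group gT}) (a b : gT) :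
  H \subset G -> a \in G -> b \in G -> a \notin H -> b \notin H ->
  a^-1 \in dcosets2 H a b -> b^-1 \in dcosets2 H a b ->
  connection_set G H (dcosets2 H a b).
Proof.
move=> sHG aG bG aH bH aV bV.
have dbl : H * dcosets2 H a b * H = dcosets2 H a b.
  have e c : H * (H :* c * H) * H = H :* c * H.
    by rewrite !mulgA mulGid -!mulgA mulGid.
  by rewrite /dcosets2 mulgU mulUg !e.
have inD x u y : x \in H -> u \in dcosets2 H a b -> y \in H ->
    x * u * y \in dcosets2 H a b.
  by move=> xH uD yH; rewrite -dbl !mem_mulg.
have Delt d : d \in dcosets2 H a b ->
    exists x y c, [/\ x \in H, y \in H, c = a \/ c = b & d = x * c * y].
  case/setUP=> /mulsgP[_ y /rcosetP[x xH ->] yH ->].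
    by exists x, y, a; split=> //; left.
  by exists x, y, b; split=> //; right.
have subV d : d \in dcosets2 H a b -> d^-1 \in dcosets2 H a b.
  case/Delt=> x [y [c [xH yH hc ->]]]; rewrite !invMg mulgA.
  by apply: inD; rewrite ?groupV //; case: hc => ->.
split=> //.
- apply/subsetP => d /Delt[x [y [c [xH yH hc ->]]]].
  have cG : c \in G by case: hc => ->.
  by apply: groupM; [apply: groupM|]; rewrite // (subsetP sHG).
- apply/setP => d; rewrite inE; apply/idP/idP; last exact: subV.
  by move/subV; rewrite invgK.
- apply/pred0P => d /=; apply/negP => /andP[/Delt[x [y [c [xH yH hc ->]]]]].
  have cH : c \notin H by case: hc => ->.
  by rewrite groupMr // groupMl // (negPf cH).
Qed.

(** * Cycle notation *)

(* The points 1, ..., n+1 are encoded by the ordinals 0, ..., n. *)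
Definition pt (n : nat) (k : nat) : 'I_n.+1 := inord k.-1.

(* The product of permutations is [(s * t) x = t (s x)], so
   (x y1 ... yk) = (x y1) * ... * (x yk). *)
Definition cyc (n : nat) (s : seq nat) : 'S_n.+1 :=
  if s is x :: s' then \prod_(y <- s') tperm (pt n x) (pt n y) else 1.

Definition cycles (n : nat) (cs : seq (seq nat)) : 'S_n.+1 :=
  \prod_(s <- cs) cyc n s.
Arguments cycles {n} cs.

Definition valid_cycle (n : nat) (s : seq nat) : bool :=
  uniq s && all (fun k => 0 < k <= n.+1) s.

Lemma pt_eq (n i j : nat) :
  0 < i <= n.+1 -> 0 < j <= n.+1 -> (pt n i == pt n j) = (i == j).
Proof.
case: i j => [|i] [|j] //= hi hj; apply/eqP/eqP => [|-> //].
by move/(congr1 val); rewrite /= !inordK // => e; congr _.+1.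
Qed.

Lemma cyc_fix (n x i : nat) (u : seq nat) :
  0 < x <= n.+1 -> 0 < i <= n.+1 -> all (fun k => 0 < k <= n.+1) u ->
  i != x -> i \notin u ->
  (\prod_(y <- u) tperm (pt n x) (pt n y)) (pt n i) = pt n i.
Proof.
move=> nx ni; elim: u => [|y u IH]; first by rewrite big_nil perm1.
case/andP=> ny nu ix; rewrite inE negb_or big_cons permM => /andP[iy iu].
by rewrite tpermD ?pt_eq // 1?eq_sym //; apply: IH.
Qed.

Lemma cyc_first (n x : nat) (s : seq nat) :
  valid_cycle n (x :: s) ->
  (\prod_(y <- s) tperm (pt n x) (pt n y)) (pt n x) = pt n (head x s).
Proof.
case: s => [|y s]; first by rewrite big_nil perm1.
case/and3P=> /andP[xs ys] nx /andP[ny ns].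
rewrite big_cons permM tpermL; apply: cyc_fix => //.
  by move: xs; rewrite inE negb_or eq_sym => /andP[].
by case/andP: ys.
Qed.

Lemma cyc_next (n x y i : nat) (s : seq nat) :
  valid_cycle n (x :: s) -> 0 < i <= n.+1 -> i != x -> i != y ->
  (\prod_(z <- s) tperm (pt n x) (pt n z)) (pt n i) = pt n (next_at i x y s).
Proof.
move=> vs ni ix; elim: s y vs => [|z s IH] y /=.
  by rewrite big_nil perm1 => _ /negPf ->.
case/and3P=> /andP[xs us] nx /andP[nz ns] /negPf ->.
move: xs; rewrite inE negb_or => /andP[xz xs].
have vs : valid_cycle n (x :: s).
  by apply/and3P; split=> //=; rewrite xs; case/andP: us.
rewrite big_cons permM; have [ez|iz] := eqVneq i z.
  rewrite ez tpermR cyc_first //.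
  by case: (s) => [|w t] /=; rewrite eqxx.
by rewrite tpermD ?pt_eq // 1?eq_sym //; apply: IH.
Qed.

Lemma cycE (n : nat) (s : seq nat) (i : nat) :
  valid_cycle n s -> 0 < i <= n.+1 -> cyc n s (pt n i) = pt n (next s i).
Proof.
case: s => [|x s] vs ni; first by rewrite perm1.
rewrite /cyc; have [->|ix] := eqVneq i x.
  by rewrite cyc_first //= ; case: (s) => [|y t] /=; rewrite eqxx.
by rewrite (cyc_next vs ni ix ix).
Qed.

(* The permutations [cycles cs] evaluate on the points 1, ..., n+1 by
   computation in nat. *)
Definition evaln (cs : seq (seq nat)) (i : nat) : nat :=
  foldl (fun j s => next s j) i cs.

Definition eqn_cycles (n : nat) (cs ds : seq (seq nat)) : bool :=
  all (fun i => evaln cs i == evaln ds i) (iota 1 n.+1).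

Lemma evaln_bound (n : nat) (cs : seq (seq nat)) (i : nat) :
  all (valid_cycle n) cs -> 0 < i <= n.+1 -> 0 < evaln cs i <= n.+1.
Proof.
elim: cs i => [|s cs IH] i //= /andP[/andP[_ /allP vs] vcs] ni; apply: IH => //.
have [si|si] := boolP (i \in s); first by apply: vs; rewrite mem_next.
by rewrite next_nth (negPf si).
Qed.

Lemma cycles_pt (n : nat) (cs : seq (seq nat)) (i : nat) :
  all (valid_cycle n) cs -> 0 < i <= n.+1 ->
  @cycles n cs (pt n i) = pt n (evaln cs i).
Proof.
rewrite /cycles; elim: cs i => [|s cs IH] i /=; first by rewrite big_nil perm1.
case/andP=> vs vcs ni; rewrite big_cons permM cycE // IH //.
by have := @evaln_bound n [:: s] i; rewrite /= vs; apply.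
Qed.

Lemma pt_val (n : nat) (x : 'I_n.+1) : x = pt n x.+1.
Proof. by rewrite /pt inord_val. Qed.

Lemma eqn_cyclesP (n : nat) (cs ds : seq (seq nat)) :
  all (valid_cycle n) cs -> all (valid_cycle n) ds ->
  (@cycles n cs == @cycles n ds) = eqn_cycles n cs ds.
Proof.
move=> vc vd; apply/eqP/allP => [e i|e].
  rewrite mem_iota add1n ltnS => ni; rewrite -(@pt_eq n) ?evaln_bound //.
  by rewrite -!cycles_pt // e.
apply/permP => x; have nx : 0 < x.+1 <= n.+1 by rewrite ltnS ltn_ord.
rewrite (pt_val x) !cycles_pt //; congr (pt n _).
by apply/eqP/e; rewrite mem_iota add1n.
Qed.

Lemma cycles_cat (n : nat) (cs ds : seq (seq nat)) :
  @cycles n (cs ++ ds) = cycles cs * cycles ds.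
Proof. exact: big_cat. Qed.

Lemma cycles1 (n : nat) : @cycles n [::] = 1.
Proof. exact: big_nil. Qed.

Lemma odd_cyc (n : nat) (s : seq nat) :
  valid_cycle n s -> odd_perm (cyc n s) = odd (size s).-1.
Proof.
case: s => [|x s]; first by rewrite odd_perm1.
rewrite /cyc; elim: s => [|y s IH]; first by rewrite big_nil odd_perm1.
case/and3P=> /andP[xs us] nx /andP[ny ns].
move: xs; rewrite inE negb_or => /andP[xy xs].
rewrite big_cons odd_permM odd_tperm pt_eq // xy IH /=; last first.
  by apply/and3P; split=> //=; rewrite xs; case/andP: us.
by case: (size s).
Qed.

Definition oddn (cs : seq (seq nat)) : bool :=
  foldr (fun s b => odd (size s).-1 (+) b) false cs.

Lemma odd_cycles (n : nat) (cs : seq (seq nat)) :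
  all (valid_cycle n) cs -> odd_perm (@cycles n cs) = oddn cs.
Proof.
rewrite /cycles; elim: cs => [|s cs IH] /=; first by rewrite big_nil odd_perm1.
by case/andP=> vs vcs; rewrite big_cons odd_permM odd_cyc // IH.
Qed.

(* Criterion for a, b to give a connection set for H = <h1, h2>, where
   H = {1, h1, h2, h1 h2}. *)
Definition data_check (n : nat) (h1 h2 a b : seq (seq nat)) : bool :=
  let L := [:: [::]; h1; h2; h1 ++ h2] in
  let ab := [:: a; b] in
  [&& all (all (valid_cycle n)) [:: h1; h2; a; b],
      all (fun x => all (fun h => has (eqn_cycles n (x ++ h)) L) [:: h1; h2]) L,
      all (fun c => ~~ has (eqn_cycles n c) L) ab
    & all (fun c => has (fun x => has (fun d => has (fun y =>
        eqn_cycles n (c ++ (x ++ d ++ y)) [::]) L) ab) L) ab].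

Lemma data_checkP (n : nat) (G H : {group 'S_n.+1}) (h1 h2 a b : seq (seq nat)) :
  data_check n h1 h2 a b ->
  H :=: <<[set cycles h1; cycles h2]>> ->
  cycles h1 \in G -> cycles h2 \in G -> cycles a \in G -> cycles b \in G ->
  connection_set G H (dcosets2 H (cycles a) (cycles b)).
Proof.
set L := [:: [::]; h1; h2; h1 ++ h2].
case/and4P=> /and5P[v1 v2 va vb _] clo notin inv defH h1G h2G aG bG.
have h1H : cycles h1 \in H by rewrite defH mem_gen ?set21.
have h2H : cycles h2 \in H by rewrite defH mem_gen ?set22.
have vL x : x \in L -> all (valid_cycle n) x.
  by rewrite !inE => /or4P[]/eqP-> //; rewrite all_cat v1.
have LH x : x \in L -> @cycles n x \in H.
  rewrite !inE => /or4P[]/eqP-> //; first by rewrite cycles1.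
  by rewrite cycles_cat groupM.
have HL x : x \in H -> exists2 u, u \in L & x = cycles u.
  rewrite defH => /gen_prodgP[k [c hc ->]] {x}.
  elim: k c hc => [|k IH] c hc.
    by exists [::]; rewrite ?inE // big_ord0 cycles1.
  rewrite big_ord_recr /=.
  have [u uL ->] := IH (fun i => c (widen_ord (leqnSn k) i)) (fun i => hc _).
  have [h hh ->] : exists2 h, h \in [:: h1; h2] & c ord_max = cycles h.
    by case/set2P: (hc ord_max) => ->; [exists h1|exists h2]; rewrite ?inE ?eqxx ?orbT.
  have vh : all (valid_cycle n) h by move: hh; rewrite !inE => /orP[]/eqP->.
  have /allP/(_ u uL)/allP/(_ h hh)/hasP[w wL e] := clo.
  exists w => //; apply/eqP.
  by rewrite -cycles_cat eqn_cyclesP ?all_cat ?(vL u) ?(vL w).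
have notH c : c \in [:: a; b] -> cycles c \notin H.
  move=> hc; have vc : all (valid_cycle n) c by move: hc; rewrite !inE => /orP[]/eqP->.
  apply/negP => /HL[u uL e].
  have /allP/(_ c hc)/negP := notin; apply; apply/hasP; exists u => //.
  by rewrite -eqn_cyclesP ?(vL u) // e.
have inD c : c \in [:: a; b] ->
    (cycles c)^-1 \in dcosets2 H (cycles a) (cycles b).
  move=> hc; have vab d : d \in [:: a; b] -> all (valid_cycle n) d.
    by rewrite !inE => /orP[]/eqP->.
  have /allP/(_ c hc)/hasP[x xL /hasP[d hd /hasP[y yL]]] := inv.
  rewrite -eqn_cyclesP ?all_cat ?(vL x) ?(vL y) ?(vab c) ?(vab d) // cycles1 cycles_cat -eq_invg_mul.
  move/eqP->; rewrite !cycles_cat mulgA.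
  have inDc : cycles x * cycles d * cycles y \in H :* cycles d * H.
    by rewrite mem_mulg ?LH // mem_rcoset mulgK LH.
  by move: hd; rewrite inE => /predU1P[ed|/predU1P[ed|//]];
    rewrite /dcosets2 inE -ed inDc ?orbT.
apply: dcosets2_connection => //; try by [apply: notH; rewrite !inE eqxx ?orbT
  | apply: inD; rewrite !inE eqxx ?orbT].
by rewrite defH gen_subG subUset !sub1set h1G.
Qed.

(** * The nine graphs *)

Definition S5_in_S7 : {group 'S_7} := perm.Sym_group [set i : 'I_7 | i < 5].
Definition A5_in_S7 : {group 'S_7} := (S5_in_S7 :&: 'Alt_('I_7))%G.
Definition z67 : 'S_7 := cycles [:: [:: 6; 7]].
(* internal direct products *)
Definition A5xZ2 : {group 'S_7} := (A5_in_S7 <*> <[z67]>)%G.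
Definition S5xZ2 : {group 'S_7} := (S5_in_S7 <*> <[z67]>)%G.

Lemma mem_S5 (cs : seq (seq nat)) :
  all (valid_cycle 6) cs -> (evaln cs 6 == 6) && (evaln cs 7 == 7) ->
  cycles cs \in S5_in_S7.
Proof.
move=> vs /andP[/eqP e6 /eqP e7]; rewrite inE; apply/subsetP => x.
rewrite !inE; apply: contraR; rewrite -leqNgt => x5.
rewrite (pt_val x) cycles_pt //; last by rewrite ltnS ltn_ord.
have : (x == 5 :> nat) || (x == 6 :> nat).
  by case: x x5 => [[|[|[|[|[|[|[|k]]]]]]] hx].
by case/orP=> /eqP->; rewrite ?e6 ?e7.
Qed.

Lemma mem_A5 (cs : seq (seq nat)) :
  all (valid_cycle 6) cs -> (evaln cs 6 == 6) && (evaln cs 7 == 7) ->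
  ~~ oddn cs -> cycles cs \in A5_in_S7.
Proof.
by move=> vs e o; rewrite inE mem_S5 //= Alt_even odd_cycles.
Qed.

Lemma mem_prodZ (A : {group 'S_7}) (cs : seq (seq nat)) (e : nat) :
  cycles cs \in A -> cycles (cs ++ nseq e [:: 6; 7]) \in (A <*> <[z67]>)%G.
Proof.
move=> cA; rewrite cycles_cat groupM //; first exact/mem_gen/setUP/or_introl.
have -> : cycles (nseq e [:: 6; 7]) = z67 ^+ e.
  elim: e => [|e IH]; first by rewrite cycles1.
  by rewrite (cycles_cat 6 [:: [:: 6; 7]]) IH expgS.
by apply/mem_gen/setUP/or_intror; rewrite mem_cycle.
Qed.

(* so that the label 1 is a natural number *)
Local Open Scope nat_scope.

Definition NC0_h : 'S_5 := cycles [:: [:: 1; 3]; [:: 2; 5]].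
Definition NC0_H : {group 'S_5} := <[NC0_h]>%G.
Definition NC0_a : 'S_5 := cycles [:: [:: 1; 2; 4; 5; 3]].
Definition NC0_b : 'S_5 := cycles [:: [:: 2; 5]].

Lemma NC0_connection :
  connection_set [set: 'S_5]%G NC0_H (dcosets2 NC0_H NC0_a NC0_b).
Proof.
apply: (@data_checkP _ _ _ [:: [:: 1; 3]; [:: 2; 5]]
    [:: [:: 1; 3]; [:: 2; 5]]).
- by vm_compute.
- by rewrite setUid.
- by rewrite inE.
- by rewrite inE.
- by rewrite inE.
- by rewrite inE.
Qed.

Definition NC0 : sgraph := Cos NC0_connection.


Definition NC1_h : 'S_7 := cycles [:: [:: 2; 3]; [:: 4; 5]].
Definition NC1_H : {group 'S_7} := <[NC1_h]>%G.
Definition NC1_a : 'S_7 := cycles [:: [:: 2; 5]; [:: 3; 4]; [:: 6; 7]].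
Definition NC1_b : 'S_7 := cycles [:: [:: 1; 2]; [:: 3; 4]; [:: 6; 7]].

Lemma NC1_connection :
  connection_set A5xZ2 NC1_H (dcosets2 NC1_H NC1_a NC1_b).
Proof.
apply: (@data_checkP _ _ _ [:: [:: 2; 3]; [:: 4; 5]]
    [:: [:: 2; 3]; [:: 4; 5]]).
- by vm_compute.
- by rewrite setUid.
- by apply: (@mem_prodZ _ [:: [:: 2; 3]; [:: 4; 5]] 0); apply: mem_A5.
- by apply: (@mem_prodZ _ [:: [:: 2; 3]; [:: 4; 5]] 0); apply: mem_A5.
- by apply: (@mem_prodZ _ [:: [:: 2; 5]; [:: 3; 4]] 1); apply: mem_A5.
- by apply: (@mem_prodZ _ [:: [:: 1; 2]; [:: 3; 4]] 1); apply: mem_A5.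
Qed.

Definition NC1 : sgraph := Cos NC1_connection.


Definition NC2_h : 'S_7 := cycles [:: [:: 2; 3]; [:: 4; 5]].
Definition NC2_H : {group 'S_7} := <[NC2_h]>%G.
Definition NC2_a : 'S_7 := cycles [:: [:: 1; 2; 4; 5; 3]].
Definition NC2_b : 'S_7 := cycles [:: [:: 2; 4]; [:: 3; 5]; [:: 6; 7]].

Lemma NC2_connection :
  connection_set A5xZ2 NC2_H (dcosets2 NC2_H NC2_a NC2_b).
Proof.
apply: (@data_checkP _ _ _ [:: [:: 2; 3]; [:: 4; 5]]
    [:: [:: 2; 3]; [:: 4; 5]]).
- by vm_compute.
- by rewrite setUid.
- by apply: (@mem_prodZ _ [:: [:: 2; 3]; [:: 4; 5]] 0); apply: mem_A5.
- by apply: (@mem_prodZ _ [:: [:: 2; 3]; [:: 4; 5]] 0); apply: mem_A5.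
- by apply: (@mem_prodZ _ [:: [:: 1; 2; 4; 5; 3]] 0); apply: mem_A5.
- by apply: (@mem_prodZ _ [:: [:: 2; 4]; [:: 3; 5]] 1); apply: mem_A5.
Qed.

Definition NC2 : sgraph := Cos NC2_connection.


Definition NC3_h : 'S_7 := cycles [:: [:: 2; 3]; [:: 4; 5]].
Definition NC3_H : {group 'S_7} := <[NC3_h]>%G.
Definition NC3_a : 'S_7 := cycles [:: [:: 1; 3; 5; 4; 2]; [:: 6; 7]].
Definition NC3_b : 'S_7 := cycles [:: [:: 2; 4]; [:: 3; 5]].

Lemma NC3_connection :
  connection_set A5xZ2 NC3_H (dcosets2 NC3_H NC3_a NC3_b).
Proof.
apply: (@data_checkP _ _ _ [:: [:: 2; 3]; [:: 4; 5]]
    [:: [:: 2; 3]; [:: 4; 5]]).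
- by vm_compute.
- by rewrite setUid.
- by apply: (@mem_prodZ _ [:: [:: 2; 3]; [:: 4; 5]] 0); apply: mem_A5.
- by apply: (@mem_prodZ _ [:: [:: 2; 3]; [:: 4; 5]] 0); apply: mem_A5.
- by apply: (@mem_prodZ _ [:: [:: 1; 3; 5; 4; 2]] 1); apply: mem_A5.
- by apply: (@mem_prodZ _ [:: [:: 2; 4]; [:: 3; 5]] 0); apply: mem_A5.
Qed.

Definition NC3 : sgraph := Cos NC3_connection.


Definition NC4_h1 : 'S_7 := cycles [:: [:: 1; 3]].
Definition NC4_h2 : 'S_7 := cycles [:: [:: 4; 5]].
Definition NC4_H : {group 'S_7} := <<[set NC4_h1; NC4_h2]>>%G.
Definition NC4_a : 'S_7 := cycles [:: [:: 1; 3; 2]; [:: 4; 5]].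
Definition NC4_b : 'S_7 := cycles [:: [:: 1; 5; 3; 4]; [:: 6; 7]].

Lemma NC4_connection :
  connection_set S5xZ2 NC4_H (dcosets2 NC4_H NC4_a NC4_b).
Proof.
apply: (@data_checkP _ _ _ [:: [:: 1; 3]]
    [:: [:: 4; 5]]).
- by vm_compute.
- by [].
- by apply: (@mem_prodZ _ [:: [:: 1; 3]] 0); apply: mem_S5.
- by apply: (@mem_prodZ _ [:: [:: 4; 5]] 0); apply: mem_S5.
- by apply: (@mem_prodZ _ [:: [:: 1; 3; 2]; [:: 4; 5]] 0); apply: mem_S5.
- by apply: (@mem_prodZ _ [:: [:: 1; 5; 3; 4]] 1); apply: mem_S5.
Qed.

Definition NC4 : sgraph := Cos NC4_connection.


Definition NC5_h1 : 'S_7 := cycles [:: [:: 1; 3]; [:: 6; 7]].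
Definition NC5_h2 : 'S_7 := cycles [:: [:: 4; 5]; [:: 6; 7]].
Definition NC5_H : {group 'S_7} := <<[set NC5_h1; NC5_h2]>>%G.
Definition NC5_a : 'S_7 := cycles [:: [:: 2; 5]].
Definition NC5_b : 'S_7 := cycles [:: [:: 1; 4; 3; 5]; [:: 6; 7]].

Lemma NC5_connection :
  connection_set S5xZ2 NC5_H (dcosets2 NC5_H NC5_a NC5_b).
Proof.
apply: (@data_checkP _ _ _ [:: [:: 1; 3]; [:: 6; 7]]
    [:: [:: 4; 5]; [:: 6; 7]]).
- by vm_compute.
- by [].
- by apply: (@mem_prodZ _ [:: [:: 1; 3]] 1); apply: mem_S5.
- by apply: (@mem_prodZ _ [:: [:: 4; 5]] 1); apply: mem_S5.
- by apply: (@mem_prodZ _ [:: [:: 2; 5]] 0); apply: mem_S5.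
- by apply: (@mem_prodZ _ [:: [:: 1; 4; 3; 5]] 1); apply: mem_S5.
Qed.

Definition NC5 : sgraph := Cos NC5_connection.


Definition NC6_h1 : 'S_7 := cycles [:: [:: 1; 3]; [:: 6; 7]].
Definition NC6_h2 : 'S_7 := cycles [:: [:: 4; 5]; [:: 6; 7]].
Definition NC6_H : {group 'S_7} := <<[set NC6_h1; NC6_h2]>>%G.
Definition NC6_a : 'S_7 := cycles [:: [:: 2; 4]].
Definition NC6_b : 'S_7 := cycles [:: [:: 1; 4]; [:: 3; 5]; [:: 6; 7]].

Lemma NC6_connection :
  connection_set S5xZ2 NC6_H (dcosets2 NC6_H NC6_a NC6_b).
Proof.
apply: (@data_checkP _ _ _ [:: [:: 1; 3]; [:: 6; 7]]
    [:: [:: 4; 5]; [:: 6; 7]]).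
- by vm_compute.
- by [].
- by apply: (@mem_prodZ _ [:: [:: 1; 3]] 1); apply: mem_S5.
- by apply: (@mem_prodZ _ [:: [:: 4; 5]] 1); apply: mem_S5.
- by apply: (@mem_prodZ _ [:: [:: 2; 4]] 0); apply: mem_S5.
- by apply: (@mem_prodZ _ [:: [:: 1; 4]; [:: 3; 5]] 1); apply: mem_S5.
Qed.

Definition NC6 : sgraph := Cos NC6_connection.


Definition NC7_h1 : 'S_8 := cycles [:: [:: 1; 7]; [:: 2; 4]; [:: 3; 8]].
Definition NC7_h2 : 'S_8 := cycles [:: [:: 1; 4]; [:: 2; 7]; [:: 5; 6]].
Definition NC7_H : {group 'S_8} := <<[set NC7_h1; NC7_h2]>>%G.
Definition NC7_a : 'S_8 := cycles [:: [:: 1; 8; 4]; [:: 2; 7; 3]].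
Definition NC7_b : 'S_8 := cycles [:: [:: 1; 4; 2; 7]; [:: 3; 6; 8; 5]].

Definition NC7_G : {group 'S_8} := <<NC7_H :|: [set NC7_a; NC7_b]>>%G.

Lemma NC7_connection :
  connection_set NC7_G NC7_H (dcosets2 NC7_H NC7_a NC7_b).
Proof.
have HG : NC7_H \subset NC7_G by rewrite sub_gen // subsetUl.
apply: (@data_checkP _ _ _ [:: [:: 1; 7]; [:: 2; 4]; [:: 3; 8]]
    [:: [:: 1; 4]; [:: 2; 7]; [:: 5; 6]]).
- by vm_compute.
- by [].
- by rewrite (subsetP HG) // mem_gen // set21.
- by rewrite (subsetP HG) // mem_gen // set22.
- by rewrite mem_gen // !inE eqxx ?orbT.
- by rewrite mem_gen // !inE eqxx ?orbT.
Qed.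

Definition NC7 : sgraph := Cos NC7_connection.


Definition NC8_h1 : 'S_8 := cycles [:: [:: 1; 6]; [:: 2; 4]; [:: 3; 7]; [:: 5; 8]].
Definition NC8_h2 : 'S_8 := cycles [:: [:: 1; 4]; [:: 2; 6]; [:: 3; 8]; [:: 5; 7]].
Definition NC8_H : {group 'S_8} := <<[set NC8_h1; NC8_h2]>>%G.
Definition NC8_a : 'S_8 := cycles [:: [:: 1; 3; 5; 2; 6; 7; 8; 4]].
Definition NC8_b : 'S_8 := cycles [:: [:: 1; 5; 2; 3]; [:: 4; 8; 6; 7]].

Definition NC8_G : {group 'S_8} := <<NC8_H :|: [set NC8_a; NC8_b]>>%G.

Lemma NC8_connection :
  connection_set NC8_G NC8_H (dcosets2 NC8_H NC8_a NC8_b).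
Proof.
have HG : NC8_H \subset NC8_G by rewrite sub_gen // subsetUl.
apply: (@data_checkP _ _ _ [:: [:: 1; 6]; [:: 2; 4]; [:: 3; 7]; [:: 5; 8]]
    [:: [:: 1; 4]; [:: 2; 6]; [:: 3; 8]; [:: 5; 7]]).
- by vm_compute.
- by [].
- by rewrite (subsetP HG) // mem_gen // set21.
- by rewrite (subsetP HG) // mem_gen // set22.
- by rewrite mem_gen // !inE eqxx ?orbT.
- by rewrite mem_gen // !inE eqxx ?orbT.
Qed.

Definition NC8 : sgraph := Cos NC8_connection.


Definition NC (i : 'I_9) : sgraph :=
  nth NC0 [:: NC0; NC1; NC2; NC3; NC4; NC5; NC6; NC7; NC8] i.

(* Main.v *)
(** Right multiplication makes G act transitively on the cosets by graph
    automorphisms. Numbering the cosets in depth-first order turns each graph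
    into an explicit adjacency list, on which a backtracking search enumerates
    every candidate for an isomorphism sending vertex 0 to vertex 0; by
    transitivity this settles pairwise non-isomorphism, gives vertex stabilisers
    of order at most 4, and shows that some arc at 0 cannot be mapped to another
    one. Let p = 5 for the graphs on 60 vertices and p = 7 for those on 84. A
    regular subgroup R of Aut has index at most 4 < p, so it contains every
    element of order p; but G has two elements of order p whose product is a
    nontrivial element of a vertex stabiliser. Finally the elements of order
    3, 5 (resp. 3, 7) of G are commutators of one another, so they generate a
    perfect group, which acts nontrivially. *)

Require Import Defs.
From mathcomp Require Import all_boot all_fingroup all_solvable.

Set Implicit Arguments.
Unset Strict Implicit.
Unset Printing Implicit Defensive.

(** * Automorphisms and isomorphisms *)

Definition alist := seq (seq nat).

(** Depth-first numbering gives every vertex but 0 a smaller neighbour. This yields connectedness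
    and provides each search step with a neighbour already mapped. *)
Definition rooted (E : alist) : bool :=
  all (fun k => has (gtn k) (nth [::] E k)) (iota 1 (size E).-1).

Definition cubic_alist (E : alist) : bool :=
  all (fun r => [&& uniq r, size r == 3 & all (gtn (size E)) r]) E.

(* Partial maps are stored in reverse: the head of [r] is the image of the
   largest vertex treated so far. Injectivity is only tested among the
   neighbours of the parent of [k], which is enough to prune the search. *)
Definition extend (E F : alist) (k : nat) : seq nat -> seq (seq nat) :=
  let prev := [seq j <- nth [::] E k | j < k] in
  let par := head 0 prev in
  let sib := [seq j <- nth [::] E par | j < k] in
  fun r => let im j := nth 0 r (k.-1 - j) in
  [seq w :: r | w <- nth [::] F (im par) &
     all (fun j => w \in nth [::] F (im j)) prev &&
     all (fun j => im j != w) sib].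

(** Edges are only tested to go to edges, and injectivity only in part, so the result may contain
    more than isomorphisms: emptiness and upper bounds are conclusive, membership is not. *)
Definition search (E F : alist) (v : nat) : seq (seq nat) :=
  foldl (fun rs k => flatten (map (extend E F k) rs)) [:: [:: v]]
    (iota 1 (size E).-1).

Lemma iotaSr (m n : nat) : iota m n.+1 = rcons (iota m n) (m + n).
Proof. by rewrite -addn1 iotaD cats1. Qed.

Lemma search_sound (E F : alist) (s : nat -> nat) :
  0 < size E -> rooted E ->
  (forall i j, i < size E -> j < size E -> j \in nth [::] E i ->
     s i \in nth [::] F (s j)) ->
  {in gtn (size E) &, injective s} ->
  rev (map s (iota 0 (size E))) \in search E F (s 0).
Proof.
move=> E0 rE hom inj; rewrite /search -[in iota 0 _](prednK E0).
have: (size E).-1 < size E by rewrite prednK.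
elim: (size E).-1 => [|m IH] mE; first by rewrite inE.
rewrite (iotaSr 1) foldl_rcons add1n.
apply/flatten_mapP; exists (rev (map s (iota 0 m.+1))); first exact/IH/ltnW.
rewrite (iotaSr 0) map_rcons rev_rcons add0n /extend.
(* The list has length m+1 with the image of m at its head, so the image of j sits at position m -
   j. *)
have im j : j < m.+1 -> nth 0 (rev (map s (iota 0 m.+1))) (m.+1.-1 - j) = s j.
  move=> jm; have le : m - j < m.+1 by rewrite ltnS leq_subr.
  rewrite -[m.+1.-1]/m nth_rev ?size_map ?size_iota // subSS subKn //.
  by rewrite (nth_map 0) ?size_iota // nth_iota.
set prev := [seq j <- nth [::] E m.+1 | j < m.+1].
have prevP j : j \in prev -> j < m.+1 /\ j \in nth [::] E m.+1.
  by rewrite mem_filter => /andP[].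
(* Rootedness makes [prev] nonempty, so the default 0 of [head] does not occur. *)
have parP : head 0 prev \in prev.
  have /allP/(_ m.+1) := rE; rewrite mem_iota add1n prednK // mE.
  move=> /(_ isT)/hasP[j jE jm].
  have : j \in prev by rewrite mem_filter jE andbT.
  by case: (prev) => //= x l _; rewrite inE eqxx.
have [pm pE] := prevP _ parP.
rewrite mem_map; last by move=> x y [].
rewrite mem_filter; apply/andP; split; last by rewrite im // hom // (ltn_trans pm).
apply/andP; split; apply/allP => j.
  by case/prevP=> jm jE; rewrite im // hom // (ltn_trans jm).
rewrite mem_filter => /andP[jm _]; rewrite im //.
apply/eqP => /inj; rewrite !unfold_in /= (ltn_trans jm) // mE => /(_ isT isT) e.
by rewrite e ltnn in jm.
Qed.

(** * Graphs presented by adjacency lists *)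

Definition presents (E : alist) (X : sgraph)
    (f : nat -> vertex X) (g : vertex X -> nat) : Prop :=
  [/\ forall x, g x < size E, forall i, i < size E -> g (f i) = i,
      cancel g f & forall x y, adj x y = (g y \in nth [::] E (g x))].

(** The inverse of a permutation of a finite set is one of its powers, so preserving adjacency
    already implies reflecting it. *)
Lemma arc_preserving_Aut (X : sgraph) (t : {perm vertex X}) :
  (forall x y, adj x y -> adj (t x) (t y)) -> t \in Autg X.
Proof.
move=> tP; apply/Aut_setP => x y; apply/idP/idP => [|/tP //].
have tnP k u v : adj u v -> adj ((t ^+ k)%g u) ((t ^+ k)%g v).
  by elim: k => [|k IH] uv; rewrite ?expg0 ?perm1 // !expgSr !permM tP ?IH.
move/(tnP #[t]%g.-1); rewrite -!permM -expgS prednK ?order_gt0 //.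
by rewrite expg_order !perm1.
Qed.

Section Presented.

Variables (E : alist) (X : sgraph) (f : nat -> vertex X) (g : vertex X -> nat).
Hypothesis EX : presents E f g.

Lemma presents_cubic : cubic_alist E -> cubic X.
Proof.
case: EX => gE gf fg adjE cE x.
have rE : nth [::] E (g x) \in E by rewrite mem_nth.
have /and3P[uE /eqP sE /allP bE] := allP cE _ rE.
have -> : [set y | adj x y] = [set y in map f (nth [::] E (g x))].
  apply/setP => y; rewrite !inE adjE; apply/idP/mapP => [|[i iE ->]].
    by exists (g y).
  by rewrite gf //; exact: bE.
rewrite cardsE; have /card_uniqP-> : uniq (map f (nth [::] E (g x))).
  rewrite map_inj_in_uniq // => i j /bE iE /bE jE /(congr1 g).
  by rewrite !gf.
by rewrite size_map.
Qed.

Lemma presents_connected : rooted E -> connected X.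
Proof.
case: EX => gE gf fg adjE rE x y.
have sX : connect_sym (@adj X) by apply/sym_connect_sym/adj_sym.
have c0 z : connect (@adj X) (f 0) z.
  rewrite -(fg z); have := gE z; elim/ltn_ind: (g z) => k IH kE.
  case: k => [|k] in IH kE *; first exact: connect0.
  have /allP/(_ k.+1) := rE; rewrite mem_iota add1n (ltn_predK kE) kE.
  move=> /(_ isT)/hasP[j jE jk].
  have jlt := ltn_trans jk kE.
  apply: connect_trans (IH j jk jlt) _; apply: connect1.
  by rewrite adj_sym adjE !gf.
by apply: connect_trans (c0 y); rewrite sX.
Qed.

Definition code (t : {perm vertex X}) : seq nat :=
  map (fun i => g (t (f i))) (iota 0 (size E)).

Lemma code_search (t : {perm vertex X}) :
  0 < size E -> rooted E -> t \in Autg X ->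
  rev (code t) \in search E E (g (t (f 0))).
Proof.
case: EX => gE gf fg adjE E0 rE /Aut_setP tA.
apply: (search_sound (s := fun i => g (t (f i)))) => // [i j iE jE jEi|i j iE jE].
  by rewrite -adjE tA adj_sym adjE !gf.
by move/(can_inj fg)/perm_inj/(congr1 g); rewrite !gf.
Qed.

Lemma nth_code (t : {perm vertex X}) (i : nat) :
  i < size E -> nth 0 (code t) i = g (t (f i)).
Proof. by move=> iE; rewrite (nth_map 0) ?size_iota // nth_iota. Qed.

Lemma code_inj : injective code.
Proof.
case: EX => gE gf fg adjE t u e; apply/permP => x.
have := congr1 (nth 0 ^~ (g x)) e; rewrite !nth_code // fg.
exact: (can_inj fg).
Qed.

(** An automorphism fixing [f 0] is determined by its list of images, which occurs, reversed, in the
    search from 0 to 0. *)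
Lemma card_stab_le (m : nat) :
  0 < size E -> rooted E -> size (search E E 0) <= m ->
  #|'C_(Autg X)[f 0 | 'P]%g| <= m.
Proof.
case: EX => gE gf fg adjE E0 rE; apply: leq_trans.
rewrite -(size_map rev (search E E 0)) cardE -(size_map code); apply: uniq_leq_size.
  by rewrite map_inj_uniq ?enum_uniq //; exact: code_inj.
move=> _ /mapP[t + ->]; rewrite mem_enum => /setIP[tA].
move/astab1P; rewrite /= /aperm => t0.
rewrite -[code t]revK map_f //; have := code_search E0 rE tA.
by rewrite t0 gf.
Qed.

Lemma presents_not_symmetric (i j : nat) :
  0 < size E -> rooted E -> i < size E -> j < size E ->
  i \in nth [::] E 0 -> j \in nth [::] E 0 ->
  all (fun r => nth 0 (rev r) i != j) (search E E 0) -> ~ symmetric_graph X.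
Proof.
case: EX => gE gf fg adjE E0 rE iE jE i0 j0 /allP h sX.
have [||t tA [t0 tij]] := sX (f 0) (f i) (f 0) (f j); try by rewrite adjE !gf.
have := code_search E0 rE tA; rewrite t0 gf // => /h.
by rewrite revK nth_code // tij gf // eqxx.
Qed.

End Presented.

(** An isomorphism can be followed by an automorphism of Y carrying the image of vertex 0 to vertex
    0, so one empty search suffices. *)
Lemma presents_not_isomorphic (E F : alist) (X Y : sgraph)
    (f : nat -> vertex X) (g : vertex X -> nat)
    (f' : nat -> vertex Y) (g' : vertex Y -> nat) :
  presents E f g -> presents F f' g' -> 0 < size E -> 0 < size F -> rooted E ->
  vertex_transitive Y -> search E F 0 = [::] -> ~ isomorphic X Y.
Proof.
move=> [gE gf fg adjE] [gF gf' fg' adjF] E0 F0 rE vY sn [phi bij_phi hom].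
have [s sA es] := atransP2 vY (in_setT (phi (f 0))) (in_setT (f' 0)).
have /Aut_setP sP := sA.
suff : rev (map (fun i => g' (s (phi (f i)))) (iota 0 (size E))) \in
    search E F (g' (s (phi (f 0)))).
  by rewrite -[s (phi _)]/('P%act _ s) -es gf' // sn.
apply: (search_sound (s := fun i => g' (s (phi (f i))))) => // [i j iE jE jEi|i j iE jE].
  by rewrite -adjF sP hom adj_sym adjE !gf.
by move/(can_inj fg')/perm_inj/(bij_inj bij_phi)/(congr1 g); rewrite !gf.
Qed.

(* A regular subgroup has index |Aut_w| < p, so it contains every element of
   order p, and then no product of two of those fixes a point without being 1. *)
Lemma not_Cayley_of_order (X : sgraph) (v w : vertex X) (p : nat)
    (s t : {perm vertex X}) :
  vertex_transitive X -> prime p -> #|'C_(Autg X)[w | 'P]%g| < p ->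
  s \in Autg X -> t \in Autg X -> (s ^+ p = 1)%g -> (t ^+ p = 1)%g ->
  (s * t)%g v = v -> (s * t)%g != 1%g -> ~ Cayley X.
Proof.
move=> vX pr_p cw sA tA sp tp stv st1 [R RA [tR reg]].
have cR : #|R| = #|vertex X|.
  have := card_orbit_stab 'P R w; rewrite reg cards1 muln1.
  by rewrite (atransP tR) ?inE // cardsT => ->.
have cA : #|Autg X| < p * #|R|.
  have := card_orbit_stab 'P (Autg X) w.
  rewrite (atransP vX) ?inE // cardsT -cR => <-.
  by rewrite mulnC ltn_mul2r cardG_gt0.
have inR x : x \in Autg X -> (x ^+ p = 1)%g -> x \in R.
  (* If x were outside R, the group [<[x]>] of order p would meet R trivially, and the product of
     both would have p|R| elements inside Aut. *)
  move=> xA xp; apply: contraLR cA => xR; rewrite -leqNgt.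
  have ox : #[x]%g = p.
    apply/(prime_nt_dvdP pr_p); last by rewrite order_dvdn xp.
    by rewrite order_eq1; apply: contraNneq xR => ->; apply: group1.
  have tiRx : (R :&: <[x]> = 1)%g.
    by rewrite setIC; apply: prime_TIg; rewrite ?cycle_subG // -orderE ox.
  have := mul_cardG R <[x]>; rewrite tiRx cards1 muln1 -orderE ox mulnC => ->.
  by rewrite subset_leq_card // mul_subG // cycle_subG.
have : (s * t)%g \in 'C_R[v | 'P]%g.
  by rewrite inE groupM ?inR //; apply/astab1P.
by rewrite reg inE (negPf st1).
Qed.

(** The group [<<S>>] is perfect, hence so is its image, which is nontrivial because of [s]. *)
Lemma not_solvable_of_commutators (aT rT : finGroupType) (D G : {group aT})
    (rho : {morphism D >-> rT}) (A : {group rT}) (S : {set aT}) (s : aT) :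
  G \subset D -> (rho @* G)%g \subset A -> S \subset G ->
  (forall z, z \in S -> exists x y, [/\ x \in S, y \in S & z = [~ x, y]%g]) ->
  s \in S -> rho s != 1%g -> ~~ solvable A.
Proof.
move=> GD GA SG comS sS; apply: contraNN => solA.
have KG : <<S>>%g \subset G by rewrite gen_subG.
have KD : <<S>>%g \subset D := subset_trans KG GD.
(* By definition, the only subgroup of a solvable group contained in its own derived subgroup is
   trivial. *)
have /eqP K1 : (rho @* <<S>>)%g == 1%g.
  apply: (implyP (forallP solA (rho @* <<S>>)%G)).
  rewrite subsetI (subset_trans (morphimS _ KG)) //= -morphimR //.
  apply: morphimS; rewrite gen_subG; apply/subsetP => z /comS[x [y [xS yS ->]]].
  by rewrite mem_commg ?mem_gen.
have /set1P-> // : rho s \in [1 rT]%g.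
by rewrite -K1 mem_morphim ?mem_gen // (subsetP KD) ?mem_gen.
Qed.

(** * Right multiplication on cosets *)

Section CosetTranslations.

Variables (gT : finGroupType) (G H : {group gT}) (D : {set gT}).
Hypothesis cD : connection_set G H D.

(** ['Rs] acts on all subsets of the group; the subaction restricts it to the vertex type, and its
    domain consists of the elements that preserve the set of cosets. *)
Definition coset_action :=
  @subaction _ _ _ _ {A : {set gT} | A \in rcosets H G} 'Rs%act.

Definition translation := [morphism of actperm coset_action].

Lemma sub_translation_dom :
  G \subset subact_dom (fun A => A \in rcosets H G) 'Rs.
Proof.
rewrite /subact_dom; have -> : [set A | A \in rcosets H G] = rcosets H G.
  by apply/setP => A; rewrite inE.
exact: actsRs_rcosets.
Qed.

Lemma val_translation (x : gT) (A : Cos_vertex G H) :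
  x \in G -> val (translation x A) = (val A :* x)%g.
Proof.
move=> xG; rewrite /= actpermE [LHS]val_subact.
by rewrite (subsetP sub_translation_dom) //= rcosetE.
Qed.

Lemma translation_Aut (x : gT) : x \in G -> translation x \in Autg (Cos cD).
Proof.
move=> xG; apply: arc_preserving_Aut => A B.
rewrite /= /Cos_adj !val_translation // => /imset2P[g d gG dD e].
(* The edge {Hg, Hdg} goes to {Hgx, Hdgx}, with the same d. *)
apply/imset2P; exists (g * x)%g d => //; first by rewrite groupM.
have := congr1 (fun P : {set {set gT}} => [set (Y :* x)%g | Y in P]) e.
by rewrite !imsetU1 !imset_set1 mulgA !rcosetM.
Qed.

Lemma translation_transitive : vertex_transitive (Cos cD).
Proof.
have HG x : x \in G -> (H :* x)%g \in rcosets H G.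
  by move=> xG; rewrite mem_rcosets (subsetP (mulG_subr _ _)).
pose A0 : Cos_vertex G H := Sub (H :* 1)%g (HG _ (group1 G)).
apply/imsetP; exists A0; first by rewrite inE.
apply/setP => B; rewrite inE; symmetry; have /rcosetsP[x xG eB] := valP B.
apply/orbitP; exists (translation x); first exact: translation_Aut.
by apply: val_inj; rewrite /= /aperm val_translation //= eB mulg1.
Qed.

End CosetTranslations.

(** * Coset graphs of permutation groups as adjacency lists *)

Definition tab (n : nat) (x : 'S_n.+1) : seq nat :=
  [seq val (x i) | i <- enum 'I_n.+1].

Definition tmul (s t : seq nat) : seq nat := [seq nth 0 t i | i <- s].

Lemma nth_tab (n : nat) (x : 'S_n.+1) (i : 'I_n.+1) : nth 0 (tab x) i = x i.
Proof. by rewrite (nth_map i) ?size_enum_ord // nth_ord_enum. Qed.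

Lemma tab_inj (n : nat) : injective (@tab n).
Proof.
by move=> x y e; apply/permP => i; apply: val_inj => /=; rewrite -!nth_tab e.
Qed.

Lemma tabM (n : nat) (x y : 'S_n.+1) : tab (x * y)%g = tmul (tab x) (tab y).
Proof.
by rewrite /tmul -map_comp; apply: eq_map => i; rewrite permM /= nth_tab.
Qed.

Lemma tab1 (n : nat) : tab (1 : 'S_n.+1)%g = iota 0 n.+1.
Proof.
by rewrite -val_enum_ord; apply: eq_map => i; rewrite perm1.
Qed.

(** Cycles use labels from 1 and tables use values from 0, whence the two shifts. *)
Definition tabw (n : nat) (w : seq (seq nat)) : seq nat :=
  [seq (evaln w i.+1).-1 | i <- iota 0 n.+1].

Lemma tab_cycles (n : nat) (w : seq (seq nat)) :
  all (valid_cycle n) w -> tab (@cycles n w) = tabw n w.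
Proof.
move=> vw; rewrite /tabw -val_enum_ord -map_comp; apply: eq_map => i /=.
have ni : 0 < i.+1 <= n.+1 by rewrite ltnS ltn_ord.
rewrite {1}(pt_val i) cycles_pt // /pt inordK //.
by have /andP[] := evaln_bound vw ni; case: (evaln w i.+1).
Qed.

(** In a finite group, generated elements are products of generators without inverses, so closure
    under left multiplication by A is enough. *)
Lemma tab_gen (n : nat) (A : {set 'S_n.+1}) (L : seq (seq nat)) (x : 'S_n.+1) :
  iota 0 n.+1 \in L ->
  (forall y t, y \in A -> t \in L -> tmul (tab y) t \in L) ->
  x \in <<A>>%g -> tab x \in L.
Proof.
move=> L1 LA /gen_prodgP[k [c hc ->]] {x}; elim: k c hc => [|k IH] c hc.
  by rewrite big_ord0 tab1.
by rewrite big_ord_recl tabM; apply: LA => //; apply: IH.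
Qed.

(** * Enumeration of cosets *)

Definition four_group (n : nat) (s t : seq nat) : seq (seq nat) :=
  undup [:: iota 0 n.+1; s; t; tmul s t].

(* [L] lists the subgroup, [D] the elements leading from a coset representative
   to its neighbours, and [k] is fuel. *)
Fixpoint traverse (L D : seq (seq nat)) (k : nat) (v : seq (seq nat))
    (t : seq nat) : seq (seq nat) :=
  if k is k'.+1 then
    if has (fun h => tmul h t \in v) L then v
    else foldl (fun v e => traverse L D k' v (tmul e t)) (t :: v) D
  else v.

(** Since HcH is the union of the cosets Hch with h in H, the neighbours of Hx are the cosets
    H(chx). *)
Definition steps (L : seq (seq nat)) (s t : seq nat) : seq (seq nat) :=
  [seq tmul x h | x <- [:: s; t], h <- L].

(** Reversal restores the order of first visit, so the coset of the identity becomes vertex 0. *)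
Definition reps (n m : nat) (L D : seq (seq nat)) : seq (seq nat) :=
  rev (traverse L D m [::] (iota 0 n.+1)).

Definition cosets (L T : seq (seq nat)) : seq (seq (seq nat)) :=
  [seq [seq tmul h t | h <- L] | t <- T].

(** An element of no listed coset gets the value [size C]. *)
Definition idx (C : seq (seq (seq nat))) (t : seq nat) : nat :=
  find (fun c : seq (seq nat) => t \in c) C.

Definition neighbours (C : seq (seq (seq nat))) (D T : seq (seq nat)) : alist :=
  [seq undup [seq idx C (tmul e t) | e <- D] | t <- T].

(** That [idx] returns i on the i-th list means that the listed cosets are disjoint; the bound on E
    means that the list is closed under taking neighbours. *)
Definition coset_check (n : nat) (C : seq (seq (seq nat))) (E : alist) : bool :=
  all (fun i => all (fun t => idx C t == i) (nth [::] C i)) (iota 0 (size C)) &&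
  all (all (gtn (size C))) E && (idx C (iota 0 n.+1) < size C).

Definition four_group_check (n : nat) (s t : seq nat) : bool :=
  let L := four_group n s t in
  all (fun x => (tmul s x \in L) && (tmul t x \in L)) L.

Lemma four_groupP (n : nat) (H : {group 'S_n.+1}) (x y : 'S_n.+1) (t : seq nat) :
  H :=: <<[set x; y]>>%g -> four_group_check n (tab x) (tab y) ->
  reflect (exists2 h, h \in H & t = tab h) (t \in four_group n (tab x) (tab y)).
Proof.
move=> defH /allP clo; have xH : x \in H by rewrite defH mem_gen ?set21.
have yH : y \in H by rewrite defH mem_gen ?set22.
apply: (iffP idP) => [|[h hH ->]].
  rewrite mem_undup !inE => /or4P[]/eqP->.
  - by exists 1%g; rewrite ?group1 ?tab1.
  - by exists x.
  - by exists y.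
  - by exists (x * y)%g; rewrite ?groupM ?tabM.
apply: (@tab_gen _ [set x; y]); last by rewrite -defH.
  by rewrite mem_undup inE eqxx.
by move=> z u /set2P[]-> /clo /andP[].
Qed.

(** Adjacency comes down to yx^-1 in D. An edge {Hg, Hdg} does not tell which end is Hx; one of the
    two matchings yields the inverse of an element of D, whence the use of D^-1 = D. *)
Lemma Cos_adjE (gT : finGroupType) (G H : {group gT}) (a b : gT)
    (X Y : Cos_vertex G H) (x y : gT) :
  connection_set G H (dcosets2 H a b) -> x \in G ->
  val X = (H :* x)%g -> val Y = (H :* y)%g ->
  reflect (exists c h, [/\ c \in [:: a; b], h \in H & y \in H :* (c * h * x)])%g
    (Cos_adj (dcosets2 H a b) X Y).
Proof.
move=> cD xG eX eY; rewrite /Cos_adj eX eY.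
have memD d : reflect (exists c h, [/\ c \in [:: a; b], h \in H & d \in H :* (c * h)])%g
    (d \in dcosets2 H a b).
  apply: (iffP setUP) => [[]/mulsgP[_ h /rcosetP[k kH ->] hH ->]|].
  - by exists a, h; rewrite inE eqxx -mulgA mem_rcoset mulgK.
  - by exists b, h; rewrite !inE eqxx orbT -mulgA mem_rcoset mulgK.
  case=> c [h [hc hH /rcosetP[k kH ->]]]; rewrite mulgA.
  have cin : (k * c * h)%g \in (H :* c * H)%g.
    by rewrite mem_mulg // mem_rcoset mulgK.
  by move: hc; rewrite !inE => /orP[]/eqP<-; [left|right].
have DV d : d \in dcosets2 H a b -> d^-1%g \in dcosets2 H a b.
  by move=> dD; rewrite -(cs_inv cD) inE invgK.
suff -> : ([set H :* x; H :* y]%g \in Cos_edges G H (dcosets2 H a b)) =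
    ((y * x^-1)%g \in dcosets2 H a b).
  apply: (iffP (memD _)) => -[c [h [hc hH hy]]]; exists c, h; split=> //.
    by rewrite rcosetM mem_rcoset.
  by move: hy; rewrite rcosetM mem_rcoset.
apply/imset2P/idP => [[g d gG dD e]|yxD]; last first.
  by exists x (y * x^-1)%g => //; rewrite mulgKV.
(* The two ends differ because D is disjoint from H; this excludes the degenerate matchings. *)
have neq : (H :* g)%g <> (H :* (d * g))%g.
  move=> /rcoset_eqP; rewrite mem_rcoset invMg mulKVg groupV => dH.
  by have /pred0P/(_ d) := cs_disjoint cD; rewrite /= dD dH.
have /set2P[] : (H :* g)%g \in [set H :* x; H :* y]%g by rewrite e set21.
  move=> eg; have /set2P[ed|ed] : (H :* (d * g))%g \in [set H :* x; H :* y]%g.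
  - by rewrite e set22.
  - by case: neq; rewrite eg ed.
  have /rcosetP[k kH ->] : y \in (H :* (d * g))%g by rewrite ed rcoset_refl.
  have /rcosetP[l lH ->] : x \in (H :* g)%g by rewrite eg rcoset_refl.
  rewrite invMg !mulgA mulgK -(cs_double cD).
  by rewrite mem_mulg ?mem_mulg ?groupV.
move=> eg; have /set2P[ed|ed] : (H :* (d * g))%g \in [set H :* x; H :* y]%g.
- by rewrite e set22.
- have /rcosetP[k kH ->] : x \in (H :* (d * g))%g by rewrite ed rcoset_refl.
  have /rcosetP[l lH ->] : y \in (H :* g)%g by rewrite eg rcoset_refl.
  rewrite !invMg !mulgA mulgK -(cs_double cD).
  by rewrite mem_mulg ?mem_mulg ?groupV ?DV.
- by case: neq; rewrite eg ed.
Qed.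

Lemma traverse_all (P : seq nat -> Prop) (L D : seq (seq nat)) (m : nat)
    (v : seq (seq nat)) (t : seq nat) :
  (forall e t, e \in D -> P t -> P (tmul e t)) ->
  {in v, forall u, P u} -> P t -> {in traverse L D m v t, forall u, P u}.
Proof.
move=> PD; elim: m v t => [|m IH] v t Pv Pt //=.
case: ifP => // _.
have key D' w : {subset D' <= D} -> {in w, forall u, P u} ->
    {in foldl (fun w e => traverse L D m w (tmul e t)) w D', forall u, P u}.
  elim: D' w => [|e D' IHD] w sD Pw //=; apply: IHD.
    by move=> d dD; rewrite sD // inE dD orbT.
  by apply: IH => //; apply: PD => //; rewrite sD ?inE ?eqxx.
by apply: key => // u /predU1P[->|/Pv].
Qed.

Lemma stepsP (n : nat) (H : {set 'S_n.+1}) (a b : 'S_n.+1)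
    (L : seq (seq nat)) (e : seq nat) :
  (forall t, reflect (exists2 h, h \in H & t = tab h) (t \in L)) ->
  reflect (exists c h, [/\ c \in [:: a; b], h \in H & e = tab (c * h)%g])
    (e \in steps L (tab a) (tab b)).
Proof.
move=> LP; apply: (iffP allpairsP)
  => [[[x t] /= [xab /LP[h hH ->] ->]]|[c [h [hc hH ->]]]].
  by move: xab; rewrite !inE => /orP[]/eqP->;
    [exists a, h|exists b, h]; rewrite !inE eqxx ?orbT tabM.
exists (tab c, tab h); split=> /=; last by rewrite tabM.
  by move: hc; rewrite !inE => /orP[]/eqP->; rewrite eqxx ?orbT.
by apply/LP; exists h.
Qed.

Lemma reps_gen (n m : nat) (H : {group 'S_n.+1}) (a b : 'S_n.+1)
    (L : seq (seq nat)) (t : seq nat) :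
  (forall t, reflect (exists2 h, h \in H & t = tab h) (t \in L)) ->
  t \in reps n m L (steps L (tab a) (tab b)) ->
  exists2 x, x \in <<H :|: [set a; b]>>%g & t = tab x.
Proof.
move=> LP; set K := <<_>>%g.
have HK h : h \in H -> h \in K by move=> hH; rewrite mem_gen // inE hH.
have abK c : c \in [:: a; b] -> c \in K.
  by rewrite !inE => hc; rewrite mem_gen // !inE hc orbT.
rewrite mem_rev; apply: (@traverse_all (fun t => exists2 x, x \in K & t = tab x))
  => [e u /(stepsP _ _ _ LP)[c [h [hc hH ->]]] [x xK ->]||].
- have ck : (c * h)%g \in K by apply: groupM; [exact: abK|exact: HK].
  by exists (c * h * x)%g; [exact: groupM|rewrite -tabM].
- by [].
- by exists 1%g; rewrite ?group1 ?tab1.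
Qed.

Lemma cosets_gen (n m : nat) (H : {group 'S_n.+1}) (a b : 'S_n.+1)
    (L : seq (seq nat)) (t : seq nat) :
  (forall t, reflect (exists2 h, h \in H & t = tab h) (t \in L)) ->
  t \in flatten (cosets L (reps n m L (steps L (tab a) (tab b)))) ->
  exists2 x, x \in <<H :|: [set a; b]>>%g & t = tab x.
Proof.
move=> LP /flattenP[_ /mapP[u uT ->] /mapP[_ /LP[h hH ->] ->]].
have [x xK ->] := reps_gen LP uT; exists (h * x)%g; rewrite ?tabM //.
by rewrite groupM // mem_gen // inE hH.
Qed.

(** An upper bound for |G| and as many distinct elements of K leave no room for a proper
    subgroup. *)
Lemma sub_of_card (n : nat) (G K : {group 'S_n.+1}) (s : seq (seq nat)) :
  K \subset G -> uniq s -> (forall t, t \in s -> exists2 x, x \in K & t = tab x) ->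
  #|G| <= size s -> G \subset K.
Proof.
move=> sKG us sK; apply: contraTT => nGK; rewrite -ltnNge.
have lt : #|K| < #|G| by rewrite proper_card // /proper sKG.
apply: leq_ltn_trans lt; rewrite cardE -(size_map (@tab n)).
by apply: uniq_leq_size => // t /sK[x xK ->]; rewrite map_f ?mem_enum.
Qed.

Lemma gen_sub_connection (gT : finGroupType) (G H : {group gT}) (a b : gT) :
  connection_set G H (dcosets2 H a b) -> <<H :|: [set a; b]>>%g \subset G.
Proof.
move=> cD; rewrite gen_subG subUset (cs_subG cD); apply/subsetP => c hc.
apply: (subsetP (cs_subD cD)).
have cin : c \in (H :* c * H)%g by rewrite -{1}[c]mulg1 mem_mulg ?rcoset_refl.
by apply/setUP; case/set2P: hc => <-; [left|right].
Qed.

Lemma Cos_presents (n m : nat) (G H : {group 'S_n.+1}) (a b : 'S_n.+1)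
    (L : seq (seq nat)) (cD : connection_set G H (dcosets2 H a b)) :
  (forall t, reflect (exists2 h, h \in H & t = tab h) (t \in L)) ->
  G \subset <<H :|: [set a; b]>>%g ->
  let D := steps L (tab a) (tab b) in
  let T := reps n m L D in
  let C := cosets L T in
  coset_check n C (neighbours C D T) ->
  exists f g, presents (X := Cos cD) (neighbours C D T) f g.
Proof.
move=> LP sG D T C /andP[/andP[/allP uC /allP cE] c1].
have sHG := cs_subG cD.
have abG c : c \in [:: a; b] -> c \in G.
  move=> hc; apply: (subsetP (gen_sub_connection cD)); rewrite mem_gen //.
  by move: hc; rewrite !inE => ->; rewrite orbT.
have stepG c h x : c \in [:: a; b] -> h \in H -> x \in G -> (c * h * x)%g \in G.
  move=> hc hH xG; apply: groupM => //.
  by apply: groupM; [exact: abG|exact: (subsetP sHG)].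
have DP e := stepsP a b e LP.
have TP t : t \in T -> exists2 x, x \in G & t = tab x.
  by move/(reps_gen LP) => [x xK ->]; exists x => //; apply: subsetP xK; apply: gen_sub_connection.
have sC : size C = size T by rewrite size_map.
(* The default 1 keeps [r k] in G for every k, so that [f] is total; for listed k the choice has the
   k-th table. *)
pose r k := odflt 1%g [pick x in G | tab x == nth [::] T k].
have rG k : r k \in G by rewrite /r; case: pickP => [x /andP[]|_] //=.
have rT k : k < size C -> tab (r k) = nth [::] T k.
  rewrite sC => /(mem_nth [::])/TP[x xG ex]; rewrite ex /r.
  by case: pickP => [y /andP[_ /eqP]|/(_ x)] /=; rewrite ex // xG eqxx.
have CP k y : k < size C -> (tab y \in nth [::] C k) = (y \in H :* r k)%g.
  move=> kC; rewrite (nth_map [::]) -?sC // -rT //.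
  apply/mapP/rcosetP => [[_ /LP[h hH ->]]|[h hH ->]].
    by rewrite -tabM => /tab_inj->; exists h.
  by exists (tab h); rewrite ?tabM //; apply/LP; exists h.
have idx_lt y : (idx C (tab y) < size C) = (tab y \in flatten C).
  rewrite -has_find; apply/hasP/flattenP => -[c cC yc]; by exists c.
have idxP y : idx C (tab y) < size C -> y \in (H :* r (idx C (tab y)))%g.
  move=> lt; rewrite -CP //.
  by apply: (nth_find [::] (a := fun c => _ \in c)); rewrite has_find.
have idx_eq k y : k < size C -> y \in (H :* r k)%g -> idx C (tab y) = k.
  move=> kC; rewrite -CP // => yC; have ik : k \in iota 0 (size C) by rewrite mem_iota.
  exact: (eqP (allP (uC _ ik) _ yC)).
have flatP t : t \in flatten C ->
    exists k h, [/\ k < size C, h \in H & t = tab (h * r k)%g].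
  case/flattenP=> _ /(nthP [::])[k kC <-].
  rewrite (nth_map [::]) -?sC // -rT // => /mapP[_ /LP[h hH ->] ->].
  by exists k, h; rewrite tabM.
set E := neighbours C D T in cE *.
have sE : size E = size C by rewrite size_map.
have EP k j : k < size C ->
    reflect (exists c h, [/\ c \in [:: a; b], h \in H & j = idx C (tab (c * h * r k)%g)])
      (j \in nth [::] E k).
  move=> kC; rewrite (nth_map [::]) -?sC // mem_undup -rT //.
  apply: (iffP mapP) => [[_ /DP[c [h [hc hH ->]]] ->]|[c [h [hc hH ->]]]].
    by exists c, h; rewrite -tabM.
  by exists (tab (c * h)%g); rewrite -?tabM //; apply/DP; exists c, h.
have E_lt k j : k < size C -> j \in nth [::] E k -> j < size C.
  move=> kC jE; have Ek : nth [::] E k \in E by rewrite mem_nth ?sE.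
  exact: (allP (cE _ Ek) _ jE).
(* The union of the listed cosets contains 1 and is stable under left multiplication by H, a and b,
   so it is all of G. *)
have cover y : y \in G -> idx C (tab y) < size C.
  move=> yG; rewrite idx_lt; apply: tab_gen (subsetP sG _ yG).
    by move: c1; rewrite -tab1 idx_lt.
  move=> z t zA /flatP[k [h [kC hH ->]]]; rewrite -tabM -idx_lt mulgA.
  case/setUP: zA => [zH|/set2P zab].
    by rewrite (idx_eq k) // mem_rcoset mulgK groupM.
  apply: (E_lt k) => //; apply/EP => //; exists z, h; split=> //.
  by rewrite !inE; case: zab => ->; rewrite eqxx ?orbT.
have HG x : x \in G -> (H :* x)%g \in rcosets H G.
  by move=> xG; rewrite mem_rcosets mulSGid.
pose f k : Cos_vertex G H := Sub (H :* r k)%g (HG _ (rG k)).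
pose g (X : Cos_vertex G H) := idx C (tab (repr (val X))).
have valR (X : Cos_vertex G H) : exists2 y, y \in G & val X = (H :* y)%g.
  by have /rcosetsP[y yG e] := valP X; exists y.
have valg X : g X < size C /\ val X = (H :* r (g X))%g.
  have [y yG e] := valR X.
  have rX : repr (val X) \in (H :* y)%g by rewrite e mem_repr_rcoset.
  have rXG : repr (val X) \in G.
    by case/rcosetP: rX => h hH ->; rewrite groupM // (subsetP sHG).
  have lt := cover _ rXG; split=> //.
  by rewrite e -(rcoset_eqP rX); apply/rcoset_eqP/idxP.
have gf k : k < size C -> g (f k) = k.
  by move=> kC; apply: idx_eq => //=; apply: mem_repr_rcoset.
exists f, g; split=> [X|k|X|X Y].
- by rewrite sE; case: (valg X).
- by rewrite sE; apply: gf.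
- by apply: val_inj => /=; case: (valg X).
have [gX eX] := valg X; have [gY eY] := valg Y.
apply/(Cos_adjE cD (rG _) eX eY)/EP => // -[c [h [hc hH e]]]; exists c, h; split=> //.
  by rewrite (idx_eq (g Y)) //; move: e; rewrite !mem_rcoset -groupV invMg invgK.
have chG : (c * h * r (g X))%g \in G by rewrite stepG.
have := idxP _ (cover _ chG); rewrite -e.
by rewrite !mem_rcoset -groupV invMg invgK.
Qed.

(** * The nine graphs *)

Definition word := seq (seq nat).

(* [deg] is the number of permuted points minus one; [pr] is the prime p of the
   argument at the top. *)
Record datum := Datum
  { deg : nat; gen1 : word; gen2 : word; out1 : word; out2 : word; pr : nat }.

(** In the first four graphs H is cyclic of order 2, and its generator is given twice; [four_group]
    removes the repetitions. *)
Definition data : seq datum := [::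
  Datum 4 [:: [:: 1; 3]; [:: 2; 5]] [:: [:: 1; 3]; [:: 2; 5]]
    [:: [:: 1; 2; 4; 5; 3]] [:: [:: 2; 5]] 5;
  Datum 6 [:: [:: 2; 3]; [:: 4; 5]] [:: [:: 2; 3]; [:: 4; 5]]
    [:: [:: 2; 5]; [:: 3; 4]; [:: 6; 7]] [:: [:: 1; 2]; [:: 3; 4]; [:: 6; 7]] 5;
  Datum 6 [:: [:: 2; 3]; [:: 4; 5]] [:: [:: 2; 3]; [:: 4; 5]]
    [:: [:: 1; 2; 4; 5; 3]] [:: [:: 2; 4]; [:: 3; 5]; [:: 6; 7]] 5;
  Datum 6 [:: [:: 2; 3]; [:: 4; 5]] [:: [:: 2; 3]; [:: 4; 5]]
    [:: [:: 1; 3; 5; 4; 2]; [:: 6; 7]] [:: [:: 2; 4]; [:: 3; 5]] 5;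
  Datum 6 [:: [:: 1; 3]] [:: [:: 4; 5]]
    [:: [:: 1; 3; 2]; [:: 4; 5]] [:: [:: 1; 5; 3; 4]; [:: 6; 7]] 5;
  Datum 6 [:: [:: 1; 3]; [:: 6; 7]] [:: [:: 4; 5]; [:: 6; 7]]
    [:: [:: 2; 5]] [:: [:: 1; 4; 3; 5]; [:: 6; 7]] 5;
  Datum 6 [:: [:: 1; 3]; [:: 6; 7]] [:: [:: 4; 5]; [:: 6; 7]]
    [:: [:: 2; 4]] [:: [:: 1; 4]; [:: 3; 5]; [:: 6; 7]] 5;
  Datum 7 [:: [:: 1; 7]; [:: 2; 4]; [:: 3; 8]] [:: [:: 1; 4]; [:: 2; 7]; [:: 5; 6]]
    [:: [:: 1; 8; 4]; [:: 2; 7; 3]] [:: [:: 1; 4; 2; 7]; [:: 3; 6; 8; 5]] 7;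
  Datum 7 [:: [:: 1; 6]; [:: 2; 4]; [:: 3; 7]; [:: 5; 8]]
    [:: [:: 1; 4]; [:: 2; 6]; [:: 3; 8]; [:: 5; 7]]
    [:: [:: 1; 3; 5; 2; 6; 7; 8; 4]] [:: [:: 1; 5; 2; 3]; [:: 4; 8; 6; 7]] 7].

Definition dsub (d : datum) : seq (seq nat) :=
  four_group (deg d) (tabw (deg d) (gen1 d)) (tabw (deg d) (gen2 d)).

Definition dsteps (d : datum) : seq (seq nat) :=
  steps (dsub d) (tabw (deg d) (out1 d)) (tabw (deg d) (out2 d)).

(* 84 is the largest number of cosets, hence enough fuel. *)
Definition dreps (d : datum) : seq (seq nat) := reps (deg d) 84 (dsub d) (dsteps d).

Definition dalist (d : datum) : alist :=
  let T := dreps d in neighbours (cosets (dsub d) T) (dsteps d) T.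

(* In the groups at hand, m = 3p selects the elements of order 3 and of order p. *)
Definition torsion (n m : nat) (ts : seq (seq nat)) : seq (seq nat) :=
  [seq t <- ts | (iter m (tmul^~ t) (iota 0 n.+1) == iota 0 n.+1) && (t != iota 0 n.+1)].

Definition nonsymmetric_check (E : alist) : bool :=
  let rs := search E E 0 in let N := nth [::] E 0 in
  has (fun i => has (fun j => all (fun r => nth 0 (rev r) i != j) rs) N) N.

(* [find p s < size s] rather than [has p s]: the latter is not evaluated
   lazily by call-by-value reduction. *)
Definition perfect_check (L S : seq (seq nat)) : bool :=
  all (fun s => find (fun x => find (fun y =>
    tmul (tmul y x) s == tmul x y) S < size S) S < size S) S &&
  has (fun s => s \notin L) S.

(** With u = st in H, right multiplication by u fixes the vertex H; a coset Hr moved by u shows that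
    it acts nontrivially. *)
Definition fixing_product_check (L T P : seq (seq nat)) : bool :=
  find (fun s => find (fun t => let u := tmul s t in
    if u \in L then has (fun r => tmul r u \notin [seq tmul h r | h <- L]) T
    else false) P < size P) P < size P.

Lemma torsionP (n m : nat) (G : {set 'S_n.+1}) (ts : seq (seq nat)) (t : seq nat) :
  (forall t, t \in ts -> exists2 x, x \in G & t = tab x) -> t \in torsion n m ts ->
  exists x, [/\ x \in G, (x ^+ m = 1)%g & t = tab x].
Proof.
move=> tsG; rewrite mem_filter => /andP[/andP[/eqP tm _] /tsG[x xG et]].
exists x; split=> //; apply: tab_inj; rewrite tab1 -tm et -tab1.
by elim: {tm} m => [|m IH] //=; rewrite expgSr tabM IH.
Qed.

(** * Non-Cayley graphs and non-solvable automorphism groups *)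

Section CosetGroup.

Variables (n : nat) (G H : {group 'S_n.+1}) (D : {set 'S_n.+1}) (L : seq (seq nat)).
Hypothesis cD : connection_set G H D.
Hypothesis LP : forall t, reflect (exists2 h, h \in H & t = tab h) (t \in L).

Lemma mem_tab (x : 'S_n.+1) : (tab x \in L) = (x \in H).
Proof.
by apply/LP/idP => [[h hH /tab_inj->] //|xH]; exists x.
Qed.

Lemma translation_moves (x r : 'S_n.+1) :
  x \in G -> r \in G -> (r * x)%g \notin (H :* r)%g -> translation G H x != 1%g.
Proof.
move=> xG rG; apply: contraNneq => x1.
have rX : (H :* r)%g \in rcosets H G.
  by rewrite mem_rcosets (subsetP (mulG_subr _ _)).
pose A : Cos_vertex G H := Sub (H :* r)%g rX.
have := val_translation A xG; rewrite x1 perm1 /= -rcosetM => ->.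
exact: rcoset_refl.
Qed.

Lemma Cos_not_solvable (S : seq (seq nat)) :
  (forall t, t \in S -> exists2 x, x \in G & t = tab x) -> perfect_check L S ->
  ~~ solvable (Autg (Cos cD)).
Proof.
move=> SG /andP[/allP comS /hasP[s sS sL]]; have [x xG es] := SG s sS.
apply: (not_solvable_of_commutators (rho := translation G H)
  (S := [set x in G | tab x \in S]) (s := x) (sub_translation_dom G H)).
- apply/subsetP => _ /morphimP[y _ yG ->]; exact: translation_Aut.
- by apply/subsetP => y; rewrite inE => /andP[].
- move=> z; rewrite inE => /andP[zG /comS]; rewrite -has_find => /hasP[u uS].
  rewrite -has_find => /hasP[v vS]; have [y yG eu] := SG u uS.
  have [w wG ev] := SG v vS; rewrite eu ev -!tabM => /eqP/tab_inj e.
  exists y, w; rewrite !inE yG wG -eu -ev; split=> //.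
  (* The computed identity [w * y * z = y * w] is z = [y, w] cleared of inverses. *)
  by apply: (mulgI (w * y)%g); rewrite e /commg /conjg !mulgA mulgK mulgV mul1g.
- by rewrite inE xG -es.
- apply: (@translation_moves x 1) => //; rewrite mul1g rcoset1.
  by rewrite -mem_tab -es.
Qed.

Lemma Cos_not_Cayley (p : nat) (w : vertex (Cos cD)) (T ts : seq (seq nat)) :
  prime p -> #|'C_(Autg (Cos cD))[w | 'P]%g| < p ->
  (forall t, t \in T -> exists2 x, x \in G & t = tab x) ->
  (forall t, t \in ts -> exists2 x, x \in G & t = tab x) ->
  fixing_product_check L T (torsion n p ts) -> ~ Cayley (Cos cD).
Proof.
move=> pr_p cw TG tsG; rewrite /fixing_product_check -has_find => /hasP[s sP].
rewrite -has_find => /hasP[t tP]; have [x [xG xp ->]] := torsionP tsG sP.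
have [y [yG yp ->]] := torsionP tsG tP; rewrite -tabM mem_tab.
case: ifP => // xyH /hasP[_ /TG[r rG ->] nr].
have inD z : z \in G -> z \in subact_dom (fun A => A \in rcosets H G) 'Rs.
  exact: (subsetP (sub_translation_dom G H)).
have HX : (H :* 1)%g \in rcosets H G.
  by rewrite mem_rcosets (subsetP (mulG_subr _ _)).
pose v : vertex (Cos cD) := Sub (H :* 1)%g HX.
apply: (@not_Cayley_of_order (Cos cD) v w p (translation G H x) (translation G H y)) => //.
- exact: translation_transitive.
- exact: translation_Aut.
- exact: translation_Aut.
- by rewrite -morphX ?inD // xp morph1.
- by rewrite -morphX ?inD // yp morph1.
- apply: val_inj; rewrite -morphM ?inD //= val_translation ?groupM //=.
  by rewrite -rcosetM mul1g rcoset_id // rcoset1.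
rewrite -morphM ?inD //; apply: (@translation_moves _ r); rewrite ?groupM //.
apply: contra nr => /rcosetP[h hH e]; apply/mapP; exists (tab h).
  by rewrite mem_tab.
by rewrite -!tabM e.
Qed.

End CosetGroup.

Definition datum_check (d : datum) : bool :=
  let n := deg d in let L := dsub d in let D := dsteps d in
  let T := dreps d in let C := cosets L T in let E := neighbours C D T in
  let ts := flatten C in
  [&& all (all (valid_cycle n)) [:: gen1 d; gen2 d; out1 d; out2 d],
      four_group_check n (tabw n (gen1 d)) (tabw n (gen2 d)),
      coset_check n C E, 0 < size E, rooted E, cubic_alist E,
      nonsymmetric_check E, prime (pr d), size (search E E 0) < pr d,
      fixing_product_check L T (torsion n (pr d) ts) &
      perfect_check L (torsion n (3 * pr d) ts)].

(** Without repetitions the length bounds the order of <H, a, b> from below; otherwise the value 0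
    makes a bound on a group order fail. *)
Definition generated_order (d : datum) : nat :=
  let s := flatten (cosets (dsub d) (dreps d)) in if uniq s then size s else 0.

(** * Properties of a single graph *)

Section DatumGraph.

Variables (d : datum) (G H : {group 'S_(deg d).+1}).
Let a : 'S_(deg d).+1 := cycles (out1 d).
Let b : 'S_(deg d).+1 := cycles (out2 d).
Hypothesis cD : connection_set G H (dcosets2 H a b).
Hypothesis defH : H :=: <<[set cycles (gen1 d); cycles (gen2 d)]>>%g.
Hypothesis dOK : datum_check d.

Lemma datum_subP t : reflect (exists2 h, h \in H & t = tab h) (t \in dsub d).
Proof.
case/and3P: dOK => /and5P[v1 v2 _ _ _] fg _; rewrite /dsub -!tab_cycles //.
by apply: four_groupP => //; rewrite !tab_cycles.
Qed.

Lemma datum_steps : dsteps d = steps (dsub d) (tab a) (tab b).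
Proof. by case/andP: dOK => /and5P[_ _ va vb _] _; rewrite !tab_cycles. Qed.

Lemma datum_cosets_gen t :
  t \in flatten (cosets (dsub d) (dreps d)) ->
  exists2 x, x \in <<H :|: [set a; b]>>%g & t = tab x.
Proof. by rewrite /dreps datum_steps; apply/cosets_gen/datum_subP. Qed.

Lemma datum_generates :
  #|G| <= generated_order d -> G \subset <<H :|: [set a; b]>>%g.
Proof.
rewrite /generated_order; case: ifP => [us|_]; last by rewrite leqNgt cardG_gt0.
by apply: sub_of_card us datum_cosets_gen; apply: gen_sub_connection.
Qed.

Hypothesis sG : G \subset <<H :|: [set a; b]>>%g.

Lemma datum_presents :
  exists f g, presents (X := Cos cD) (dalist d) f g.
Proof.
case/and4P: dOK => _ _ cc _; move: cc; rewrite /dalist /dreps datum_steps.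
exact: (Cos_presents cD datum_subP sG).
Qed.

Lemma datum_properties :
  [/\ connected (Cos cD) /\ cubic (Cos cD), vertex_transitive (Cos cD),
      ~ symmetric_graph (Cos cD), ~ Cayley (Cos cD) & ~~ solvable (Autg (Cos cD))].
Proof.
have [f [g pE]] := datum_presents.
case/and5P: dOK => _ _ _ E0 /and5P[rE cE nsE pr_p /and3P[sE fp pf]].
have vX := translation_transitive cD.
have sub x : x \in <<H :|: [set a; b]>>%g -> x \in G.
  exact/subsetP/(gen_sub_connection cD).
have CG t : t \in flatten (cosets (dsub d) (dreps d)) -> exists2 x, x \in G & t = tab x.
  by case/datum_cosets_gen => x /sub xG ->; exists x.
have TG t : t \in dreps d -> exists2 x, x \in G & t = tab x.
  by rewrite /dreps datum_steps => /(reps_gen datum_subP)[x /sub xG ->]; exists x.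
split.
- by split; [apply: presents_connected pE rE|apply: presents_cubic pE cE].
- exact: vX.
- case/hasP: nsE => i i0 /hasP[j j0 nij].
  have lt k : k \in nth [::] (dalist d) 0 -> k < size (dalist d).
    have : nth [::] (dalist d) 0 \in dalist d by rewrite mem_nth.
    by move/(allP cE) => /and3P[_ _ /allP bE] /bE.
  exact: (presents_not_symmetric pE E0 rE (lt i i0) (lt j j0) i0 j0 nij).
- apply: (Cos_not_Cayley datum_subP pr_p _ TG CG fp).
  exact: leq_ltn_trans (card_stab_le pE E0 rE (leqnn _)) sE.
apply: (Cos_not_solvable cD datum_subP _ pf) => t.
by case/(torsionP CG) => x [xG _ ->]; exists x.
Qed.

End DatumGraph.

(** * Orders of the ambient groups *)

Lemma card_S5_in_S7 : #|S5_in_S7| = 120.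
Proof.
rewrite (perm.card_Sym [set i : 'I_7 | i < 5]) -sum1_card big_mkcond.
by rewrite !big_ord_recl big_ord0 !inE.
Qed.

Lemma fix_S5_in_S7 (x : 'S_7) (i : 'I_7) : x \in S5_in_S7 -> 5 <= i -> x i = i.
Proof.
by rewrite inE => xS i5; apply: (out_perm xS); rewrite inE -leqNgt.
Qed.

Lemma z67E : z67 = tperm (pt 6 6) (pt 6 7).
Proof. by rewrite /z67 /cycles big_seq1 /cyc big_seq1. Qed.

(** Permutations fixing 6 and 7 commute with (6 7). Upper bounds suffice, as enumeration bounds the
    order of <H, a, b> from below. *)
Lemma card_joinZ2_le (A : {group 'S_7}) :
  A \subset S5_in_S7 -> #|(A <*> <[z67]>)%g| <= #|A| * 2.
Proof.
move=> sA; have cz : <[z67]>%g \subset 'C(A)%g.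
  rewrite cycle_subG; apply/centP => x /(subsetP sA) xS.
  by apply/commgP/conjg_fixP; rewrite z67E tpermJ !(fix_S5_in_S7 xS) // inordK.
have z2 : #|<[z67]>%g| <= 2.
  by apply: dvdn_leq => //; rewrite -orderE order_dvdn z67E expgS expg1 tperm2.
rewrite (cent_joinEr cz); apply: leq_trans (leq_mul (leqnn _) z2).
by rewrite mul_cardG leq_pmulr // cardG_gt0.
Qed.

(** The transposition (1 2) is odd, so the index is at least 2. *)
Lemma card_A5_in_S7_le : #|A5_in_S7| * 2 <= #|S5_in_S7|.
Proof.
have sA : A5_in_S7 \subset S5_in_S7 by apply: subsetIl.
rewrite -(Lagrange sA) leq_mul2l indexg_gt1.
apply/orP; right; apply/negP => /subsetP/(_ (cycles [:: [:: 1; 2]])).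
by rewrite mem_S5 // => /(_ isT)/setIP[_]; rewrite Alt_even odd_cycles.
Qed.

(** * Computations and conclusion *)

Definition datum0 : datum := Datum 0 [::] [::] [::] [::] 0.

Definition noniso_check :=
  let Es := map dalist data in
  all (fun i => all (fun j => search (nth [::] Es i) (nth [::] Es j) 0 == [::])
    (iota 0 i)) (iota 0 (size data)).

Lemma noniso_checked : noniso_check.
Proof. by vm_compute. Qed.

Lemma data_checked : all datum_check data.
Proof. by vm_compute. Qed.

Lemma generated_orders :
  map generated_order data = [:: 120; 120; 120; 120; 240; 240; 240; 336; 336].
Proof. by vm_compute. Qed.

Lemma datum_checked (i : 'I_9) : datum_check (nth datum0 data i).
Proof. by have /(all_nthP datum0) := data_checked; apply. Qed.

Lemma generated_orderE (i : 'I_9) : generated_order (nth datum0 data i) =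
  nth 0 [:: 120; 120; 120; 120; 240; 240; 240; 336; 336] i.
Proof. by rewrite -generated_orders (nth_map datum0). Qed.

Lemma NC_datum (i : 'I_9) :
  let d := nth datum0 data i in
  exists (G H : {group 'S_(deg d).+1})
    (cD : connection_set G H (dcosets2 H (cycles (out1 d)) (cycles (out2 d)))),
  [/\ NC i = Cos cD, H :=: <<[set cycles (gen1 d); cycles (gen2 d)]>>%g &
      G \subset <<H :|: [set cycles (out1 d); cycles (out2 d)]>>%g].
Proof.
(* 120 and 240 are the numbers of elements of <H, a, b> enumerated, so these bounds force G = <H, a,
   b>. *)
have A5le : #|A5xZ2| <= 120.
  apply: leq_trans (card_joinZ2_le (subsetIl _ _)) _.
  by rewrite -card_S5_in_S7 card_A5_in_S7_le.
have S5le : #|S5xZ2| <= 240.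
  by apply: leq_trans (card_joinZ2_le (subxx _)) _; rewrite card_S5_in_S7.
have gen := fun G H cD defH =>
  @datum_generates (nth datum0 data i) G H cD defH (datum_checked i).
rewrite generated_orderE in gen.
case: i gen => [[|[|[|[|[|[|[|[|[|//]]]]]]]]] i9] gen.
- exists [set: 'S_5]%G, NC0_H, NC0_connection.
  have defH : NC0_H :=: <<[set NC0_h; NC0_h]>>%g by rewrite setUid.
  split=> //; apply: (gen _ _ NC0_connection defH).
  by rewrite cardsT card_Sn.
- exists A5xZ2, NC1_H, NC1_connection.
  have defH : NC1_H :=: <<[set NC1_h; NC1_h]>>%g by rewrite setUid.
  by split=> //; apply: (gen _ _ NC1_connection defH).
- exists A5xZ2, NC2_H, NC2_connection.
  have defH : NC2_H :=: <<[set NC2_h; NC2_h]>>%g by rewrite setUid.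
  by split=> //; apply: (gen _ _ NC2_connection defH).
- exists A5xZ2, NC3_H, NC3_connection.
  have defH : NC3_H :=: <<[set NC3_h; NC3_h]>>%g by rewrite setUid.
  by split=> //; apply: (gen _ _ NC3_connection defH).
- exists S5xZ2, NC4_H, NC4_connection.
  by split=> //; apply: (gen _ _ NC4_connection erefl).
- exists S5xZ2, NC5_H, NC5_connection.
  by split=> //; apply: (gen _ _ NC5_connection erefl).
- exists S5xZ2, NC6_H, NC6_connection.
  by split=> //; apply: (gen _ _ NC6_connection erefl).
(* On 84 vertices G is generated by H, a, b by definition. *)
- by exists NC7_G, NC7_H, NC7_connection.
- by exists NC8_G, NC8_H, NC8_connection.
Qed.

Theorem theorem5p2 :
  (forall i j : 'I_9, i != j -> ~ isomorphic (NC i) (NC j)) /\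
  (forall i : 'I_9,
    [/\ connected (NC i) /\ cubic (NC i),
        vertex_transitive (NC i),
        ~ symmetric_graph (NC i),
        ~ Cayley (NC i)
      & ~~ solvable (Autg (NC i))]).
Proof.
have props i : [/\ connected (NC i) /\ cubic (NC i), vertex_transitive (NC i),
    ~ symmetric_graph (NC i), ~ Cayley (NC i) & ~~ solvable (Autg (NC i))].
  have [G [H [cD [-> defH sG]]]] := NC_datum i.
  exact: (datum_properties cD defH (datum_checked i) sG).
(* Isomorphism is symmetric, so the pairs j < i covered by [noniso_check] suffice. *)
split=> // i j; wlog ji : i j / j < i => [wl|_].
  rewrite neq_ltn => /orP[lt|lt]; last by apply: wl; rewrite // neq_ltn lt orbT.
  move=> [f bf hf]; apply: (wl j i) => //; first by rewrite neq_ltn lt orbT.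
  have [f' ff' f'f] := bf; exists f'; first by exists f.
  by move=> x y; rewrite -hf !f'f.
have pres (k : 'I_9) : exists f g, presents (X := NC k) (dalist (nth datum0 data k)) f g.
  have [G [H [cD [-> defH sG]]]] := NC_datum k.
  exact: (datum_presents cD defH (datum_checked k) sG).
have [f [g pi]] := pres i; have [f' [g' pj]] := pres j.
have E0 (k : 'I_9) : 0 < size (dalist (nth datum0 data k)) /\ rooted (dalist (nth datum0 data k)).
  by case/and5P: (datum_checked k) => _ _ _ s0 /and3P[r _ _].
apply: (presents_not_isomorphic pi pj (E0 i).1 (E0 j).1 (E0 i).2).
  by case: (props j).
have iD : i < size data := ltn_ord i; have jD : j < size data := ltn_ord j.
have hi : val i \in iota 0 (size data) by rewrite mem_iota.
have hj : val j \in iota 0 i by rewrite mem_iota.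
have := allP (allP noniso_checked _ hi) _ hj.
by rewrite !(nth_map datum0) // => /eqP.
Qed.
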